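(* Let $f(z)\in K[[z]]$ and let $n\ge 1$. Suppose that $f$ satisfies the $k$-Mahler equation $$f(z)=\sum_{i=1}^{n}c_i(z)\,f\bigl(z^{k^i}\bigr),\qquad c_i(z)\in K(z),$$ that $f$ satisfies no $k$-Mahler equation of order less than $n$, and that none of the rational functions $c_1,\dots,c_n$ has a pole at a root of unity. Then $f$ is $k$-regular if and only if there exist $N\ge 1$ and a $k$-calm sequence of rational functions $(e_i(z))_{i=1}^N$ such that $f(z)=\sum_{i=1}^N e_i(z)f(z^{k^i})$.
   Context: Throughout, $K$ is an algebraically closed field of characteristic $0$ or $p>0$, and $k\ge 2$ is an integer; if $\operatorname{char}K=p>0$ then $k$ is coprime to $p$. A $k$-Mahler equation of order $N\ge 0$ satisfied by $f\in K[[z]]$ is an identity $f(z)=\sum_{i=1}^{N}e_i(z)f(z^{k^i})$ with $e_i\in K(z)$ (for $N=0$ it reads $f=0$). A sequence $(a_i)_{i\ge0}$ in $K$ is $k$-regular if the $K$-vector subspace of $K^{\mathbf N}$ spanned by its $k$-kernel $\{(a_{k^e i+r})_{i\ge 0}: e\ge 0,\ 0\le r<k^e\}$ is finite dimensional; a power series $\sum a_iz^i$ is $k$-regular if its coefficient sequence is. A number $\alpha\in K$ is $k$-calm if $\alpha=0$ or $\alpha$ is a root of unity whose order is not coprime to $k$; otherwise $\alpha$ is $k$-anxious. A rational function is $k$-calm if it has no poles at $k$-anxious numbers, and a finite sequence of rational functions is $k$-calm if each of its terms is $k$-calm. *)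

(* Defs.v *)
From HB Require Import structures.
From mathcomp Require Import all_boot all_order all_algebra.
From mathcomp Require Import boolp classical_sets functions.

Set Implicit Arguments.
Unset Strict Implicit.
Unset Printing Implicit Defensive.
Import GRing.Theory.
Local Open Scope ring_scope.

Notation "x %:F" := (FracField.tofrac x).

Section PowerSeries.
Variable R : idomainType.

Record fps := Fps { fcoef : nat -> R }.

HB.instance Definition _ := gen_eqMixin fps.
HB.instance Definition _ := gen_choiceMixin fps.

Implicit Types f g h : fps.

Lemma fpsP f g : (forall n, fcoef f n = fcoef g n) -> f = g.
Proof. by case: f g => f [g] /= fg; congr Fps; apply/funext. Qed.

Definition fps0 := Fps (fun=> 0).
Definition fps_opp f := Fps (fun n => - fcoef f n).
Definition fps_add f g := Fps (fun n => fcoef f n + fcoef g n).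

Lemma fps_addA : associative fps_add.
Proof. by move=> f g h; apply: fpsP => n /=; rewrite addrA. Qed.
Lemma fps_addC : commutative fps_add.
Proof. by move=> f g; apply: fpsP => n /=; rewrite addrC. Qed.
Lemma fps_add0 : left_id fps0 fps_add.
Proof. by move=> f; apply: fpsP => n /=; rewrite add0r. Qed.
Lemma fps_addN : left_inverse fps0 fps_opp fps_add.
Proof. by move=> f; apply: fpsP => n /=; rewrite addNr. Qed.

HB.instance Definition _ :=
  GRing.isZmodule.Build fps fps_addA fps_addC fps_add0 fps_addN.

Definition fps_of_poly (p : {poly R}) := Fps (fun n => p`_n).

Definition fps1 := fps_of_poly 1.
Definition fps_mul f g :=
  Fps (fun n => \sum_(i < n.+1) fcoef f i * fcoef g (n - i)%N).

Definition fps_trunc m f : {poly R} := \poly_(i < m) fcoef f i.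

Lemma fcoef_mul_trunc m f g n : (n < m)%N ->
  fcoef (fps_mul f g) n = (fps_trunc m f * fps_trunc m g)`_n.
Proof.
move=> nm; rewrite coefM /=; apply: eq_bigr => i _; rewrite !coef_poly.
by rewrite !(leq_ltn_trans _ nm) // ?leq_subr // -ltnS ltn_ord.
Qed.

Lemma eq_coefM (p p' q q' : {poly R}) n :
  (forall i, (i <= n)%N -> p`_i = p'`_i) ->
  (forall i, (i <= n)%N -> q`_i = q'`_i) -> (p * q)`_n = (p' * q')`_n.
Proof.
move=> pp' qq'; rewrite !coefM; apply: eq_bigr => i _.
by rewrite pp' ?qq' ?leq_subr // -ltnS ltn_ord.
Qed.

Lemma coef_trunc_mul m f g n : (n < m)%N ->
  (fps_trunc m (fps_mul f g))`_n = (fps_trunc m f * fps_trunc m g)`_n.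
Proof. by move=> nm; rewrite coef_poly nm (fcoef_mul_trunc _ _ nm). Qed.

Lemma fps_mulA : associative fps_mul.
Proof.
move=> f g h; apply: fpsP => n; rewrite !(@fcoef_mul_trunc n.+1) //.
set F := fps_trunc n.+1 f; set H := fps_trunc n.+1 h.
pose G := fps_trunc n.+1 g.
transitivity (F * (G * H))`_n.
  by apply: eq_coefM => // i ni; rewrite coef_trunc_mul.
by rewrite mulrA; apply: eq_coefM => // i ni; rewrite coef_trunc_mul.
Qed.

Lemma fps_mulC : commutative fps_mul.
Proof.
by move=> f g; apply: fpsP => n; rewrite !(@fcoef_mul_trunc n.+1) // mulrC.
Qed.

Lemma fps_mul1 : left_id fps1 fps_mul.
Proof.
move=> f; apply: fpsP => n /=.
rewrite big_ord_recl /= coef1 mul1r subn0 big1 ?addr0 // => i _.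
by rewrite coef1 mul0r.
Qed.

Lemma fps_mulDl : left_distributive fps_mul fps_add.
Proof.
move=> f g h; apply: fpsP => n /=; rewrite -big_split.
by apply: eq_bigr => i _ /=; rewrite mulrDl.
Qed.

Lemma fps1_neq0 : fps1 != 0 :> fps.
Proof.
apply/eqP => /(congr1 (fun f => fcoef f 0)) /=; rewrite coef1 => /eqP.
by rewrite oner_eq0.
Qed.

HB.instance Definition _ := GRing.Zmodule_isComNzRing.Build fps
  fps_mulA fps_mulC fps_mul1 fps_mulDl fps1_neq0.

Definition fps_unit : {pred fps} := fun f => `[< exists g, g * f = 1 >].
Definition fps_inv f : fps :=
  if pselect (exists g, g * f = 1) is left e then projT1 (cid e) else f.

Lemma fps_mulV : {in fps_unit, left_inverse 1 fps_inv *%R}.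
Proof.
move=> f /asboolP uf; rewrite /fps_inv.
by case: pselect => // e; exact: (projT2 (cid e)).
Qed.

Lemma fps_unitP f g : g * f = 1 -> fps_unit f.
Proof. by move=> gf; apply/asboolP; exists g. Qed.

Lemma fps_inv_out : {in [predC fps_unit], fps_inv =1 id}.
Proof.
move=> f /negP nuf; rewrite /fps_inv; case: pselect => // e.
by case: nuf; apply/asboolP.
Qed.

HB.instance Definition _ := GRing.ComNzRing_hasMulInverse.Build fps
  fps_mulV fps_unitP fps_inv_out.

Lemma fps_valuation f : f != 0 ->
  exists2 m, fcoef f m != 0 & forall i, (i < m)%N -> fcoef f i = 0.
Proof.
move=> f0; have ex : exists n, fcoef f n != 0.
  apply: contrapT => nex; case/eqP: f0; apply: fpsP => n.
  by apply/eqP/negPn/negP => fn; apply: nex; exists n.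
case: (ex_minnP ex) => m fm minm; exists m => // i im.
by apply/eqP; apply: contraTT im => /minm; rewrite -leqNgt.
Qed.

Lemma fps_integral f g : f * g = 0 -> (f == 0) || (g == 0).
Proof.
move=> fg; apply/norP => -[/fps_valuation[m fm f0] /fps_valuation[n gn g0]].
have mn : (m < (m + n).+1)%N by rewrite ltnS leq_addr.
have /= := congr1 (fun h => fcoef h (m + n)) fg.
rewrite (bigD1 (Ordinal mn)) //= addKn big1 ?addr0 => [/eqP|i].
  by rewrite mulf_eq0 (negPf fm) (negPf gn).
rewrite -val_eqE /= neq_ltn => /orP[im|mi]; first by rewrite f0 ?mul0r.
rewrite [X in _ * X]g0 ?mulr0 // ltn_subLR ?ltn_add2r //.
by rewrite -ltnS.
Qed.

HB.instance Definition _ := GRing.ComUnitRing_isIntegral.Build fps fps_integral.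

Lemma fps_of_poly_zmod : zmod_morphism fps_of_poly.
Proof. by move=> p q; apply: fpsP => n /=; rewrite coefB. Qed.

Lemma fps_of_poly_monoid : monoid_morphism fps_of_poly.
Proof. by split=> [//|p q]; apply: fpsP => n; rewrite /= coefM. Qed.

HB.instance Definition _ :=
  GRing.isZmodMorphism.Build {poly R} fps fps_of_poly fps_of_poly_zmod.
HB.instance Definition _ :=
  GRing.isMonoidMorphism.Build {poly R} fps fps_of_poly fps_of_poly_monoid.

Lemma fps_of_poly_inj : injective fps_of_poly.
Proof. by move=> p q [pq]; apply/polyP => i; exact: (congr1 (@^~ i) pq). Qed.

(* f(z^m); only meaningful for m > 0 *)
Definition fps_subst_pow (m : nat) (f : fps) : fps :=
  Fps (fun n => if (m %| n)%N then fcoef f (n %/ m)%N else 0).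

End PowerSeries.

Section Laurent.
Variable K : fieldType.

Definition ratfun : Type := {fraction {poly K}}.
HB.instance Definition _ := GRing.Field.on ratfun.

(* K((z)), as the fraction field of K[[z]] *)
Definition laurent : Type := {fraction (fps K)}.
HB.instance Definition _ := GRing.Field.on laurent.

Definition laurent_of_ratfun (e : ratfun) : laurent :=
  (fps_of_poly \n_(repr e))%:F / (fps_of_poly \d_(repr e))%:F.

Lemma fps_of_poly_eq0 (p : {poly K}) :
  ((fps_of_poly p)%:F == 0 :> laurent) = (p == 0).
Proof.
by rewrite tofrac_eq0 -(rmorph0 (@fps_of_poly K)) (inj_eq (@fps_of_poly_inj K)).
Qed.

Lemma ratfun_repr (e : ratfun) :
  \d_(repr e) != 0 /\ e = (\n_(repr e))%:F / (\d_(repr e))%:F.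
Proof.
have d0 := denom_ratioP (repr e); split=> //.
apply: (canRL (mulfK _)); first by rewrite tofrac_eq0.
rewrite -{1}[e]reprK; case: (repr e) d0 => -[n d] /= d0' d0.
unlock FracField.tofrac; rewrite -[LHS]FracField.pi_mul.
apply/eqmodP; rewrite /= FracField.equivfE /FracField.mulf.
by rewrite /= !numden_Ratio ?oner_eq0 ?mulr1 ?mulf_neq0 ?oner_eq0 // mulrC.
Qed.

Lemma laurent_of_ratfunE (p q : {poly K}) : q != 0 ->
  laurent_of_ratfun (p%:F / q%:F) = (fps_of_poly p)%:F / (fps_of_poly q)%:F.
Proof.
move=> q0; rewrite /laurent_of_ratfun.
have [d0 /eqP] := ratfun_repr (p%:F / q%:F).
move: (\n_ _) (\d_ _) d0 => n d d0.
rewrite eqr_div ?tofrac_eq0 // -!tofracM tofrac_eq => /eqP pd.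
apply/eqP; rewrite eqr_div ?fps_of_poly_eq0 //.
by rewrite -!tofracM tofrac_eq -!rmorphM /= pd.
Qed.

Lemma laurent_of_ratfun_zmod : zmod_morphism laurent_of_ratfun.
Proof.
move=> e e'; have [d0 ->] := ratfun_repr e; have [d'0 ->] := ratfun_repr e'.
move: (\n_ _) (\d_ _) (\n_ _) (\d_ _) d0 d'0 => n d n' d' d0 d'0.
rewrite -mulNr addf_div ?tofrac_eq0 // -tofracN -!tofracM -tofracD.
rewrite !laurent_of_ratfunE ?mulf_neq0 // -mulNr addf_div ?fps_of_poly_eq0 //.
by rewrite -tofracN -!tofracM -tofracD !rmorphD !rmorphM rmorphN.
Qed.

Lemma laurent_of_ratfun_monoid : monoid_morphism laurent_of_ratfun.
Proof.
split.
  by rewrite -[1]divr1 -tofrac1 laurent_of_ratfunE ?oner_eq0 // !rmorph1 divr1.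
move=> e e'; have [d0 ->] := ratfun_repr e; have [d'0 ->] := ratfun_repr e'.
move: (\n_ _) (\d_ _) (\n_ _) (\d_ _) d0 d'0 => n d n' d' d0 d'0.
rewrite mulf_div -!tofracM !laurent_of_ratfunE ?mulf_neq0 //.
by rewrite mulf_div -!tofracM !rmorphM.
Qed.

HB.instance Definition _ := GRing.isZmodMorphism.Build ratfun laurent
  laurent_of_ratfun laurent_of_ratfun_zmod.
HB.instance Definition _ := GRing.isMonoidMorphism.Build ratfun laurent
  laurent_of_ratfun laurent_of_ratfun_monoid.

End Laurent.

Section Mahler.
Variables (K : fieldType) (k : nat).

(* The coefficient e_i of f(z^(k^i)), for i = 1, ..., N, is [e (i-1)]. *)
Definition mahler_equation (N : nat) (e : 'I_N -> ratfun K) (f : fps K) : Prop :=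
  f%:F = \sum_(i < N)
    laurent_of_ratfun (e i) * (fps_subst_pow (k ^ i.+1) f)%:F :> laurent K.

Definition is_root_of_unity (a : K) : Prop :=
  exists2 m, (0 < m)%N & m.-unity_root a.

Definition calm_number (a : K) : Prop :=
  a = 0 \/ exists2 m, m.-primitive_root a & ~~ coprime m k.

Definition anxious_number (a : K) : Prop := ~ calm_number a.

Definition has_pole (e : ratfun K) (a : K) : Prop :=
  exists p q : {poly K},
    [/\ q != 0, coprimep p q, e = p%:F / q%:F & root q a].

Definition calm_ratfun (e : ratfun K) : Prop :=
  forall a, anxious_number a -> ~ has_pole e a.

Definition calm_sequence (N : nat) (e : 'I_N -> ratfun K) : Prop :=
  forall i, calm_ratfun (e i).

End Mahler.

Section Regular.
Local Open Scope classical_set_scope.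

Definition linear_span (K : fieldType) (V : lmodType K) (S : set V) : set V :=
  [set v | exists m (a : 'I_m -> K) (w : 'I_m -> V),
    (forall i, S (w i)) /\ v = \sum_(i < m) a i *: w i].

Definition finite_dimensional (K : fieldType) (V : lmodType K) (W : set V) :
  Prop := exists m (b : 'I_m -> V), W = linear_span (range b).

Definition kernel_seqs (K : fieldType) (k : nat) (u : nat -> K^o) :
    set (nat -> K^o) :=
  [set v | exists e r, (r < k ^ e)%N /\ v = (fun i => u (k ^ e * i + r)%N)].

Definition regular_seq (K : fieldType) (k : nat) (u : nat -> K^o) : Prop :=
  finite_dimensional (linear_span (kernel_seqs k u)).

Definition regular_fps (K : fieldType) (k : nat) (f : fps K) : Prop :=
  regular_seq k (fcoef f).

End Regular.

(* Main.v *)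
From HB Require Import structures.
Require Import Defs.
From mathcomp Require Import all_boot all_order all_algebra.
From mathcomp Require Import boolp classical_sets functions zify.

Set Implicit Arguments.
Unset Strict Implicit.
Unset Printing Implicit Defensive.
Import GRing.Theory.
Local Open Scope ring_scope.

(** Write (M f)(z) = f(z^k), and Lambda_r for the operator sending a sequence
    (a_i) to (a_(k i + r)), so that Lambda_r (g * M h) = Lambda_r g * h.

    Regular implies calm.  The polynomials q with q f in the K[z]-module spanned
    by the M^i f, i >= 1, form an ideal; it suffices that its generator only
    vanishes at 0.  At a root of unity the common denominator of the c_i does
    not vanish.  The equation makes K(z) f + K(z) M f + ... stable under all
    Lambda_r, so a common denominator b clears the finite dimensional span of
    the k-kernel, and f = sum_(r < k^e) z^r M^e (Lambda_(e,r) f) puts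
    b(z^(k^e)) in the ideal for every e >= 1.  If x is neither 0 nor a root of
    unity, the x^(k^e) are distinct, hence b(x^(k^e)) <> 0 for some e.

    Calm implies regular.  If x has order m not coprime to k, put
    l = m / gcd(m, k): then x is a root of z^(l k^i) - 1 for i >= 1 but not of
    z^l - 1.  Dividing f by a product u of such binomials z^l - 1 yields g with
    z^a g = sum_(i >= 1) r_i M^i g, where the r_i are polynomials.  The series v
    such that z^a v is a combination of g, M g, ..., M^N g with polynomial
    coefficients of bounded degree form a finite dimensional space, stable under
    all Lambda_r, which contains f. *)

(** * Substitution and section operators *)

(** The operator Lambda_r in base [m]; with [m = k ^ e] it yields the elements of the k-kernel. *)
Definition cartier (R : idomainType) (m r : nat) (f : fps R) : fps R :=
  Fps (fun i => fcoef f (m * i + r)%N).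

Section Substitution.
Variable R : idomainType.
Implicit Types (f g h : fps R) (p q : {poly R}).

Lemma fcoef_mul f g n :
  fcoef (f * g) n = \sum_(i < n.+1) fcoef f (n - i)%N * fcoef g i.
Proof. by rewrite mulrC; apply: eq_bigr => i _; rewrite mulrC. Qed.

Lemma fcoef_sum I (r : seq I) (P : pred I) (F : I -> fps R) n :
  fcoef (\sum_(i <- r | P i) F i) n = \sum_(i <- r | P i) fcoef (F i) n.
Proof. by elim/big_rec2: _ => //= i x y _ <-. Qed.

Lemma fcoef_subst m f n :
  fcoef (fps_subst_pow m f) n = if (m %| n)%N then fcoef f (n %/ m) else 0.
Proof. by []. Qed.

Lemma fcoef_mul_subst m f g n : (0 < m)%N ->
  fcoef (f * fps_subst_pow m g) n
    = \sum_(j < (n %/ m).+1) fcoef f (n - m * j)%N * fcoef g j.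
Proof.
move=> m_gt0; rewrite fcoef_mul.
rewrite (bigID (fun i : 'I_n.+1 => m %| i)%N) /=.
rewrite [X in _ + X]big1 ?addr0; last by move=> i /negPf ->; rewrite mulr0.
have le_j (j : 'I_(n %/ m).+1) : (m * j < n.+1)%N.
  by rewrite ltnS mulnC -leq_divRL // -ltnS ltn_ord.
have le_i (i : 'I_n.+1) : (i %/ m < (n %/ m).+1)%N.
  by rewrite ltnS leq_div2r // -ltnS ltn_ord.
rewrite (reindex_onto (fun j : 'I_(n %/ m).+1 => Ordinal (le_j j))
  (fun i => Ordinal (le_i i))) /=; last first.
  by move=> i mi; apply/val_inj; rewrite /= mulnC divnK.
apply: eq_big => [j|j _]; last by rewrite dvdn_mulr ?mulKn.
by rewrite dvdn_mulr //= -val_eqE /= mulKn ?eqxx.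
Qed.

Lemma subst_pow_zmod m : zmod_morphism (@fps_subst_pow R m).
Proof.
by move=> f g; apply: fpsP => n /=; case: ifP => //; rewrite subr0.
Qed.

HB.instance Definition _ m := GRing.isZmodMorphism.Build (fps R) (fps R)
  (@fps_subst_pow R m) (subst_pow_zmod m).

Lemma subst_pow_poly m p : (0 < m)%N ->
  fps_subst_pow m (fps_of_poly p) = fps_of_poly (p \Po 'X^m).
Proof. by move=> m0; apply: fpsP => n; rewrite /= coef_comp_poly_Xn. Qed.

Lemma subst_powM m f g : (0 < m)%N ->
  fps_subst_pow m (f * g) = fps_subst_pow m f * fps_subst_pow m g.
Proof.
move=> m0; apply: fpsP => n; rewrite fcoef_mul_subst //.
rewrite fcoef_subst; case: ifPn => mn.
  rewrite fcoef_mul; apply: eq_bigr => j _ /=.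
  rewrite dvdn_subr ?dvdn_mulr // ?mn.
    by rewrite mulnC divnBMl.
  by rewrite mulnC -leq_divRL // -ltnS.
rewrite big1 // => j _ /=.
rewrite dvdn_subl ?dvdn_mulr // ?(negPf mn) ?mul0r //.
by rewrite mulnC -leq_divRL // -ltnS.
Qed.

Lemma subst_pow_comp m1 m2 f : (0 < m1)%N ->
  fps_subst_pow m1 (fps_subst_pow m2 f) = fps_subst_pow (m1 * m2) f.
Proof.
move=> m1_gt0; apply: fpsP => n /=; case: ifPn => m1n.
  by rewrite divnMA dvdn_divRL // [(m2 * m1)%N]mulnC.
by case: ifPn => // /(dvdn_trans (dvdn_mulr _ (dvdnn _))); rewrite (negPf m1n).
Qed.

Lemma subst_pow1 f : fps_subst_pow 1 f = f.
Proof. by apply: fpsP => n; rewrite /= dvd1n divn1. Qed.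

Lemma fcoef_cartier m r f n : fcoef (cartier m r f) n = fcoef f (m * n + r).
Proof. by []. Qed.

Lemma cartier_zmod m r : zmod_morphism (@cartier R m r).
Proof. by move=> f g; apply: fpsP. Qed.

HB.instance Definition _ m r := GRing.isZmodMorphism.Build (fps R) (fps R)
  (@cartier R m r) (cartier_zmod m r).

Lemma cartier_mul_subst m r f g : (r < m)%N ->
  cartier m r (f * fps_subst_pow m g) = cartier m r f * g.
Proof.
move=> rm; have m0 : (0 < m)%N by apply: leq_trans rm.
apply: fpsP => n; rewrite fcoef_cartier fcoef_mul_subst // fcoef_mul.
rewrite mulnC divnMDl // divn_small // addn0.
apply: eq_bigr => i _ /=; congr (fcoef f _ * _).
by rewrite mulnBr [(n * m)%N]mulnC addnBAC // leq_mul2l -ltnS ltn_ord orbT.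
Qed.

(** The crude bound [size p] loses no coefficient when [m > 0], since then [m * i + r >= i]. *)
Definition poly_cartier m r p : {poly R} := \poly_(i < size p) p`_(m * i + r).

Lemma cartier_poly m r p : (0 < m)%N ->
  cartier m r (fps_of_poly p) = fps_of_poly (poly_cartier m r p).
Proof.
move=> m0; apply: fpsP => n /=; rewrite coef_poly; case: ltnP => // le_pn.
rewrite nth_default // (leq_trans le_pn) //.
by rewrite (leq_trans (leq_pmull n m0)) ?leq_addr.
Qed.

(** Sections divide sizes by [m]; this offsets the growth of degrees when an equation is applied. *)
Lemma size_poly_cartier m r p D : (size p <= m * D)%N ->
  (size (poly_cartier m r p) <= D)%N.
Proof.
move=> pD; apply/leq_sizeP => j Dj; rewrite coef_poly; case: ifP => // _.
rewrite nth_default // (leq_trans pD) // (leq_trans _ (leq_addr _ _)) //.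
by rewrite leq_mul2l Dj orbT.
Qed.

Lemma cartier_decomposition m f : (0 < m)%N ->
  f = \sum_(r < m) fps_of_poly 'X^r * fps_subst_pow m (cartier m r f).
Proof.
move=> m0; apply: fpsP => n; rewrite fcoef_sum.
under eq_bigr => r _ do rewrite fcoef_mul_subst //=.
have e : (n - m * (n %/ m))%N = (n %% m)%N.
  by rewrite {1}(divn_eq n m) mulnC addKn.
have nm : (n %% m < m)%N by rewrite ltn_mod.
(* In degree [n] only one product survives: the residue [n %% m] with the last index [n %/ m]. *)
rewrite (bigD1 (Ordinal nm)) //= [X in _ + X]big1 ?addr0 => [|r rn].
  rewrite big_ord_recr /= big1 ?add0r => [|i _].
    by rewrite coefXn e eqxx mul1r mulnC -divn_eq.
  rewrite coefXn; case: eqP => [|_]; last by rewrite mul0r.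
  have := ltn_ord i; have := divn_eq n m; have := nm; nia.
rewrite big1 // => i _; rewrite coefXn.
case: eqP => [ri|_]; last by rewrite mul0r.
case/eqP: rn; apply: val_inj => /=.
have : (m * i <= n)%N by rewrite mulnC -leq_divRL // -ltnS.
move=> /subnK <-; rewrite ri [(m * i)%N]mulnC addnC modnMDl modn_small //.
Qed.

(** A section in base [k ^ e] is a composite of base [k] sections, one per digit of [r], the lowest
    digit first. *)
Lemma cartier_pow_stable (k : nat) (S : fps R -> Prop) (f : fps R) :
  (0 < k)%N -> S f ->
  (forall r g, (r < k)%N -> S g -> S (cartier k r g)) ->
  forall e r, (r < k ^ e)%N -> S (cartier (k ^ e) r f).
Proof.
move=> k0 Sf Sk; elim=> [|e IH] r.
  rewrite expn0; case: r => // _; rewrite (_ : cartier _ _ _ = f) //.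
  by apply: fpsP => n /=; rewrite mul1n addn0.
move=> rk; have ke0 : (0 < k ^ e)%N by rewrite expn_gt0 k0.
rewrite (_ : cartier _ _ _
  = cartier k (r %/ k ^ e) (cartier (k ^ e) (r %% k ^ e) f)).
  by apply: Sk; [rewrite ltn_divLR // -expnS | apply: IH; rewrite ltn_mod].
apply: fpsP => n /=; congr (fcoef f _).
by rewrite mulnDr -addnA [(k ^ e * (r %/ _))%N]mulnC -divn_eq expnSr mulnA.
Qed.

End Substitution.

(** * Finite dimensional spans *)

Section LinearSpan.
Variables (K : fieldType) (V : lmodType K).
Implicit Types (S T : set V) (Q : V -> Prop).

Lemma linear_span_gen S v : S v -> linear_span S v.
Proof.
move=> Sv; exists 1%N, (fun=> 1), (fun=> v); split=> //.
by rewrite big_ord1 scale1r.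
Qed.

Lemma linear_span_ind S Q : Q 0 ->
  (forall a v w, S v -> Q w -> Q (a *: v + w)) ->
  forall v, linear_span S v -> Q v.
Proof.
move=> Q0 QD _ [m [a [w [Sw ->]]]].
by elim/big_rec: _ => // i v _; exact: QD.
Qed.

Lemma linear_spanDZ S a v w :
  linear_span S v -> linear_span S w -> linear_span S (a *: v + w).
Proof.
move=> [m1 [c1 [w1 [Sw1 ->]]]] [m2 [c2 [w2 [Sw2 ->]]]].
exists (m1 + m2)%N, (fun i => match fintype.split i with
  inl j => a * c1 j | inr j => c2 j end).
exists (fun i => match fintype.split i with inl j => w1 j | inr j => w2 j end).
split=> [i|]; first by case: fintype.split => j.
rewrite big_split_ord /= scaler_sumr; congr (_ + _).
  by apply: eq_bigr => i _; rewrite (unsplitK (inl i)) scalerA.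
by apply: eq_bigr => i _; rewrite (unsplitK (inr i)).
Qed.

Lemma linear_span0 S : linear_span S 0.
Proof.
by exists 0%N, (fun=> 0), (fun=> 0); split=> [[]//|]; rewrite big_ord0.
Qed.

Lemma linear_span_sub S T :
  (forall v, S v -> linear_span T v) ->
  forall v, linear_span S v -> linear_span T v.
Proof.
move=> ST; apply: linear_span_ind => [|a v w /ST Tv Tw].
  exact: linear_span0.
exact: linear_spanDZ.
Qed.

(* [C v x] reads "x is a coordinate vector of v"; it need not be unique. *)
Lemma finite_dimensional_coord M (C : V -> 'rV[K]_M -> Prop) S :
  (forall v, C v 0 -> v = 0) -> C 0 0 ->
  (forall a v x w y, C v x -> C w y -> C (a *: v + w) (a *: x + y)) ->
  (forall v, S v -> exists x, C v x) ->
  finite_dimensional (linear_span S).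
Proof.
move=> Cinj C0 CDZ CS.
(* Coordinate matrices of finite families in [S] have rank at most [M]; a family of maximal rank
   will generate the span. *)
pose P r := `[< exists m (s : 'I_m -> V) (A : 'M[K]_(m, M)),
  (forall i, S (s i) /\ C (s i) (row i A)) /\ \rank A = r >].
have exP : exists r, P r.
  exists 0%N; apply/asboolP; exists 0%N, (fun=> 0), 0.
  by split=> [[]//|]; rewrite mxrank0.
have ubP r : P r -> (r <= M)%N.
  by move=> /asboolP[m [s [A [_ <-]]]]; exact: rank_leq_col.
case: (ex_maxnP exP ubP) => r /asboolP[m [s [A [sA rA]]]] max_r.
exists m, s; apply/seteqP; split=> v.
  apply: linear_span_sub => {}v Sv; have [x Cx] := CS v Sv.
  (* Otherwise stacking [x] on [A] would give a family in [S] of larger rank. *)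
  have /submxP[D xE] : (x <= A)%MS.
    have le_r : (\rank (col_mx x A) <= \rank A)%N.
      rewrite rA; apply: max_r; apply/asboolP.
      exists (1 + m)%N, (fun i => match fintype.split i with
        inl _ => v | inr j => s j end), (col_mx x A).
      split=> // i; case: (fintype.splitP i) => j ij.
        have -> : i = lshift m j by apply: val_inj.
        rewrite rowKu (_ : row j x = x) //.
        by apply/rowP => l; rewrite mxE [j]ord1.
      have -> : i = rshift 1 j by apply: val_inj.
      by rewrite rowKd; exact: sA.
    have AxA : (A <= col_mx x A)%MS by rewrite -addsmxE addsmxSr.
    rewrite (geq_leqif (mxrank_leqif_sup AxA)) col_mx_sub in le_r.
    by case/andP: le_r.
  have CD : C (\sum_i D 0 i *: s i) (D *m A).
    rewrite mulmx_sum_row; elim/big_rec2: _ => // i y w _ Cwy.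
    by apply: CDZ => //; case: (sA i).
  have := CDZ (-1) _ _ _ _ CD Cx; rewrite xE !scaleN1r addNr => /Cinj /eqP.
  rewrite addrC subr_eq0 => /eqP ->.
  by exists m, (D 0), s; split=> // i; exists i.
apply: linear_span_sub => _ [i _ <-]; apply: linear_span_gen.
by case: (sA i).
Qed.

End LinearSpan.

(** * Clearing denominators *)

Section Denominators.
Variables (K : fieldType) (k : nat).
Implicit Types (p q : {poly K}) (e : ratfun K).

Lemma ratfun_reduced e :
  exists p q, [/\ q != 0, coprimep p q & e = p%:F / q%:F].
Proof.
have [d0 ->] := ratfun_repr e; move: (\n_ _) (\d_ _) d0 => n d d0.
have g0 : gcdp n d != 0 by rewrite gcdp_eq0 negb_and d0 orbT.
exists (n %/ gcdp n d), (d %/ gcdp n d); split.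
- by rewrite divp_eq0 (negPf d0) (negPf g0) -leqNgt /= leq_gcdpr.
- by rewrite coprimep_div_gcd // d0 orbT.
- apply/eqP; rewrite eqr_div ?tofrac_eq0 //; last first.
    by rewrite divp_eq0 (negPf d0) (negPf g0) -leqNgt /= leq_gcdpr.
  by rewrite -!tofracM tofrac_eq divp_mulCA ?dvdp_gcdl ?dvdp_gcdr // mulrC.
Qed.

(** By Gauss, the denominator of a reduced form divides that of any other form. *)
Lemma has_pole_root p q a : q != 0 -> has_pole (p%:F / q%:F) a -> root q a.
Proof.
move=> q0 [p' [q' [q'0 cop /eqP]]]; rewrite eqr_div ?tofrac_eq0 //.
rewrite -!tofracM tofrac_eq => /eqP pq /root_dvdp; apply.
by rewrite -(Gauss_dvdpr q (d := q') (q := p')) 1?coprimep_sym // -pq dvdp_mull.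
Qed.

(** The fractions are reduced before their denominators are multiplied, so the product vanishes only
    at poles. *)
Lemma mahler_equation_clear N (e : 'I_N -> ratfun K) f :
  mahler_equation k e f ->
  exists q (p : 'I_N -> {poly K}),
    [/\ q != 0, forall a, root q a -> exists i, has_pole (e i) a
      & fps_of_poly q * f
        = \sum_(i < N) fps_of_poly (p i) * fps_subst_pow (k ^ i.+1) f].
Proof.
move=> eq_f; have /choice[nd ndP] (i : 'I_N) :
    exists x : {poly K} * {poly K},
      [/\ x.2 != 0, coprimep x.1 x.2 & e i = x.1%:F / x.2%:F].
  by have [p [q pq]] := ratfun_reduced (e i); exists (p, q).
exists (\prod_i (nd i).2), (fun i => (nd i).1 * \prod_(j | j != i) (nd j).2).
split.
- by apply/prodf_neq0 => i _; case: (ndP i).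
- move=> a; rewrite rootE horner_prod => /prodf_eq0[i _ ri].
  by case: (ndP i) => *; exists i, (nd i).1, (nd i).2.
- apply/eqP; rewrite -tofrac_eq tofracM [f%:F]eq_f rmorph_sum mulr_sumr.
  apply/eqP/eq_bigr => i _; have [d0 _ ->] := ndP i.
  rewrite laurent_of_ratfunE // (bigD1 i) //= !rmorphM /= mulrA; congr (_ * _).
  by rewrite mulrC -!mulrA mulKf ?fps_of_poly_eq0.
Qed.

Lemma mahler_equation_of_poly N q (p : 'I_N -> {poly K}) f : q != 0 ->
  fps_of_poly q * f
    = \sum_(i < N) fps_of_poly (p i) * fps_subst_pow (k ^ i.+1) f ->
  mahler_equation k (fun i => (p i)%:F / q%:F) f.
Proof.
move=> q0 qf; rewrite /mahler_equation.
have q0' : (fps_of_poly q)%:F != 0 :> laurent K by rewrite fps_of_poly_eq0.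
apply: (mulfI q0'); rewrite -tofracM qf rmorph_sum mulr_sumr.
apply: eq_bigr => i _; rewrite laurent_of_ratfunE // rmorphM /= mulrA.
by rewrite mulrCA mulfV // mulr1.
Qed.

End Denominators.

(** * Regular implies calm *)

Lemma Fps_linear (K : fieldType) (a : K) (v w : nat -> K^o) :
  Fps (a *: v + w : nat -> K) = fps_of_poly a%:P * Fps v + Fps w.
Proof.
apply: fpsP => n /=; congr (_ + _); rewrite big_ord_recl /= coefC subn0.
by rewrite big1 ?addr0 // => i _; rewrite coefC mul0r.
Qed.

(** * The K[z]-modules generated by the M^i f with i >= m *)

Section MahlerModule.
Variables (K : fieldType) (k : nat) (f : fps K).
Hypothesis k_gt0 : (0 < k)%N.
Implicit Types (p q : {poly K}) (g v : fps K).

Inductive mahler_span (m : nat) : fps K -> Prop :=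
| mahler_span0 : mahler_span m 0
| mahler_spanS i p g : (m <= i)%N -> mahler_span m g ->
    mahler_span m (fps_of_poly p * fps_subst_pow (k ^ i) f + g).

Lemma mahler_span_add m g1 g2 :
  mahler_span m g1 -> mahler_span m g2 -> mahler_span m (g1 + g2).
Proof.
move=> + g2m; elim=> [|i p g mi _ IH]; first by rewrite add0r.
by rewrite -addrA; exact: mahler_spanS.
Qed.

Lemma mahler_spanW m m' g : (m' <= m)%N -> mahler_span m g -> mahler_span m' g.
Proof.
move=> m'm; elim=> [|i p {}g mi _ IH]; first exact: mahler_span0.
by apply: mahler_spanS IH; exact: leq_trans mi.
Qed.

Lemma mahler_span_mul m p g :
  mahler_span m g -> mahler_span m (fps_of_poly p * g).
Proof.
elim=> [|i q {}g mi _ IH]; first by rewrite mulr0; exact: mahler_span0.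
by rewrite mulrDr mulrA -rmorphM; exact: mahler_spanS.
Qed.

Lemma mahler_span_gen m i : (m <= i)%N ->
  mahler_span m (fps_subst_pow (k ^ i) f).
Proof.
move=> mi; rewrite -[X in mahler_span _ X]mul1r -[1](rmorph1 (@fps_of_poly K)).
by rewrite -[X in mahler_span _ X]addr0; apply: mahler_spanS (mahler_span0 _).
Qed.

Lemma mahler_span_subst m e g : mahler_span m g ->
  mahler_span (m + e) (fps_subst_pow (k ^ e) g).
Proof.
have ke0 : (0 < k ^ e)%N by rewrite expn_gt0 k_gt0.
elim=> [|i q {}g mi _ IH]; first by rewrite raddf0; exact: mahler_span0.
rewrite raddfD /= subst_powM // subst_pow_poly // subst_pow_comp //.
rewrite -expnD [(e + i)%N]addnC.
by apply: mahler_spanS; rewrite ?leq_add2r.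
Qed.

(** Every generator is M(M^i f) with i >= m, and Lambda_r (p M h) = (Lambda_r p) h. *)
Lemma mahler_span_cartier m r g : (r < k)%N -> mahler_span m.+1 g ->
  mahler_span m (cartier k r g).
Proof.
move=> rk; elim=> [|[//|i] q {}g mi _ IH].
  by rewrite raddf0; exact: mahler_span0.
rewrite raddfD /= expnS -subst_pow_comp // cartier_mul_subst // cartier_poly //.
exact: mahler_spanS.
Qed.

(** Only the term in f itself needs the factor [q]; the others already lie in the smaller module. *)
Lemma mahler_span_raise q g : mahler_span 1 (fps_of_poly q * f) ->
  mahler_span 0 g -> mahler_span 1 (fps_of_poly q * g).
Proof.
move=> qf; elim=> [|i p {}g _ _ IH].
  by rewrite mulr0; exact: mahler_span0.
rewrite mulrDr; apply: mahler_span_add => //; rewrite mulrCA.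
apply: mahler_span_mul; case: i => [|i].
  by rewrite expn0 subst_pow1.
by apply: mahler_span_mul; exact: mahler_span_gen.
Qed.

Lemma mahler_span_sum m I (r : seq I) (F : I -> fps K) :
  (forall i, mahler_span m (F i)) -> mahler_span m (\sum_(i <- r) F i).
Proof.
move=> Fm; apply: big_ind => // [|g1 g2]; first exact: mahler_span0.
exact: mahler_span_add.
Qed.

Lemma mahler_span_coef m g : mahler_span m g ->
  exists N (p : nat -> {poly K}),
    g = \sum_(i < N.+1) fps_of_poly (p i) * fps_subst_pow (k ^ (m + i)) f.
Proof.
elim=> [|j q {}g mj _ [N [p ->]]].
  by exists 0%N, (fun=> 0); rewrite big1 // => i _; rewrite raddf0 mul0r.
(* The new term enters at index [j - m]; [p] is cut off beyond [N], where its values are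
   arbitrary. *)
exists (maxn N (j - m)), (fun i => (if i == (j - m)%N then q else 0)
  + (if (i < N.+1)%N then p i else 0)).
under [RHS]eq_bigr => i _ do rewrite raddfD mulrDl.
rewrite big_split; congr (_ + _) => /=.
  have jN : (j - m < (maxn N (j - m)).+1)%N by rewrite ltnS leq_maxr.
  rewrite (bigD1 (Ordinal jN)) //= eqxx subnKC // big1 ?addr0 // => i.
  by rewrite -val_eqE /= => /negPf ->; rewrite raddf0 mul0r.
rewrite (big_ord_widen (maxn N (j - m)).+1 (fun i =>
  fps_of_poly (p i) * fps_subst_pow (k ^ (m + i)) f)) ?ltnS ?leq_maxl //.
rewrite big_mkcond; apply: eq_bigr => i _ /=.
by case: ifP => // _; rewrite raddf0 mul0r.
Qed.

(** Equivalently, v lies in the K(z)-span of the M^i f, i >= 0, inside K((z)). *)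
Definition mahler_torsion v :=
  exists2 b : {poly K}, b != 0 & mahler_span 0 (fps_of_poly b * v).

Lemma mahler_torsion0 : mahler_torsion 0.
Proof. by exists 1; rewrite ?oner_eq0 // mulr0; exact: mahler_span0. Qed.

Lemma mahler_torsionDM p v1 v2 : mahler_torsion v1 -> mahler_torsion v2 ->
  mahler_torsion (fps_of_poly p * v1 + v2).
Proof.
move=> [b1 b10 S1] [b2 b20 S2]; exists (b1 * b2); first by rewrite mulf_neq0.
rewrite mulrDr; apply: mahler_span_add; rewrite rmorphM.
  rewrite mulrCA [fps_of_poly b1 * _]mulrC -mulrA.
  by do 2!apply: mahler_span_mul.
by rewrite -mulrA; apply: mahler_span_mul.
Qed.

Lemma mahler_torsion_denominator m (v : 'I_m -> fps K) :
  (forall j, mahler_torsion (v j)) ->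
  exists2 b : {poly K}, b != 0 & forall j, mahler_span 0 (fps_of_poly b * v j).
Proof.
move=> vS; have /choice[b bP] j : exists b : {poly K},
    b != 0 /\ mahler_span 0 (fps_of_poly b * v j).
  by have [b b0 bv] := vS j; exists b.
exists (\prod_j b j) => [|j]; first by apply/prodf_neq0 => j _; case: (bP j).
rewrite (bigD1 j) //= mulrC rmorphM mulrA mulrC.
by apply: mahler_span_mul; rewrite mulrC; case: (bP j).
Qed.

End MahlerModule.

(** * Denominators of the k-kernel and the ideal of multipliers of f *)

Section RegularToCalm.
Variables (K : closedFieldType) (k : nat) (f : fps K).
Hypothesis k_gt1 : (1 < k)%N.
Implicit Types (p q b : {poly K}).
Let k_gt0 : (0 < k)%N := ltnW k_gt1.

(** Replace each root x of q by x^k: z - x divides z^k - x^k. *)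
Lemma dvdp_comp_Xn q : q != 0 ->
  exists2 b : {poly K}, b != 0 & q %| b \Po 'X^k.
Proof.
move=> q0; have [rs qE] := closed_field_poly_normal q.
exists (\prod_(x <- rs) ('X - (x ^+ k)%:P)).
  by rewrite prodf_seq_neq0; apply/allP => x _ /=; rewrite polyXsubC_eq0.
rewrite qE dvdpZl ?lead_coef_eq0 // rmorph_prod /=.
elim: rs {qE} => [|x rs IH]; first by rewrite !big_nil dvdpp.
rewrite !big_cons dvdp_mul // dvdp_XsubCl rootE horner_comp hornerXn.
by rewrite hornerXsubC subrr.
Qed.

(** The factor [q] moves b v into the module starting at M f, and a multiple of q b of the form
    b'(z^k) passes through Lambda_r as b'. *)
Lemma mahler_torsion_cartier q r v : q != 0 ->
  mahler_span k f 1 (fps_of_poly q * f) -> (r < k)%N ->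
  mahler_torsion k f v -> mahler_torsion k f (cartier k r v).
Proof.
move=> q0 qf rk [b b0 bv]; have qb0 : q * b != 0 by rewrite mulf_neq0.
have [b' b'0 /dvdpP[t b'E]] := dvdp_comp_Xn qb0; exists b' => //.
rewrite mulrC -cartier_mul_subst // subst_pow_poly // b'E mulrC.
apply: mahler_span_cartier => //; rewrite rmorphM -mulrA.
by apply: mahler_span_mul; rewrite rmorphM -mulrA; apply: mahler_span_raise.
Qed.

(** One [b] clears a finite basis of the kernel span, hence all sections of f at every level e; M^e
    then raises each b Lambda_(e,r) f into the module starting at e. *)
Lemma regular_denominator q : q != 0 ->
  mahler_span k f 1 (fps_of_poly q * f) -> regular_fps k f ->
  exists2 b : {poly K}, b != 0
    & forall e, mahler_span k f e (fps_of_poly (b \Po 'X^(k ^ e)) * f).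
Proof.
move=> q0 qf [m [w wE]].
have kerT v : kernel_seqs k (fcoef f) v -> mahler_torsion k f (Fps v).
  move=> [e [r [rk ->]]]; apply: (@cartier_pow_stable K k _ f) => //.
    exists 1; rewrite ?oner_eq0 // rmorph1 mul1r.
    by have := mahler_span_gen k f (leqnn 0); rewrite expn0 subst_pow1.
  by move=> r' g r'k; exact: mahler_torsion_cartier qf r'k.
have wT j : mahler_torsion k f (Fps (w j)).
  have : linear_span (kernel_seqs k (fcoef f)) (w j).
    by rewrite wE; apply: linear_span_gen; exists j.
  move: (w j); apply: linear_span_ind => [|a v v' Sv v'T].
    exact: mahler_torsion0.
  by rewrite Fps_linear; apply: mahler_torsionDM => //; exact: kerT.
have [b b0 bw] := mahler_torsion_denominator wT.
have bspan v : linear_span (range w) v ->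
    mahler_span k f 0 (fps_of_poly b * Fps v).
  move: v; apply: linear_span_ind => [|a _ v' [j _ <-] bv'].
    by rewrite (_ : Fps _ = 0) // mulr0; exact: mahler_span0.
  rewrite Fps_linear mulrDr mulrCA; apply: mahler_span_add => //.
  exact: mahler_span_mul.
exists b => // e; have ke0 : (0 < k ^ e)%N by rewrite expn_gt0 k_gt0.
rewrite [X in _ * X](cartier_decomposition f ke0) mulr_sumr.
apply: mahler_span_sum => r; rewrite mulrCA; apply: mahler_span_mul.
rewrite -subst_pow_poly // -subst_powM // -[e in mahler_span _ _ e]add0n.
apply: mahler_span_subst => //.
apply: (bspan (fcoef (cartier (k ^ e) r f))); rewrite -wE.
by apply: linear_span_gen; exists e, r.
Qed.

Lemma exists_pow_nonroot b a : b != 0 -> a != 0 -> ~ is_root_of_unity a ->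
  exists e, ~~ root b (a ^+ (k ^ e.+1)).
Proof.
move=> b0 a0 nu; apply: contrapT => nex.
(* These are [size b] distinct elements, one more than the degree of [b]; a coincidence would make
   [a] a root of unity. *)
have uni : uniq [seq a ^+ (k ^ e.+1) | e <- iota 0 (size b)].
  rewrite map_inj_in_uniq ?iota_uniq // => i j _ _.
  wlog lt_ij : i j / (i < j)%N => [IH|] eq_ij.
    by case: (ltngtP i j) => // [/IH|/IH]; [exact|move=> h; apply/esym/h].
  have lt_k : (k ^ i.+1 < k ^ j.+1)%N by rewrite ltn_exp2l.
  case: nu; exists (k ^ j.+1 - k ^ i.+1)%N; first by rewrite subn_gt0.
  apply/unity_rootP; have u : a ^+ (k ^ i.+1) != 0 by rewrite expf_neq0.
  by apply: (mulIf u); rewrite -exprD subnK 1?ltnW // mul1r.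
have all_b : all (root b) [seq a ^+ (k ^ e.+1) | e <- iota 0 (size b)].
  apply/allP => _ /mapP[e _ ->].
  by apply: contrapT => /negP ne; apply: nex; exists e.
by have := max_poly_roots b0 all_b uni; rewrite size_map size_iota ltnn.
Qed.

(** A nonzero multiplier of least size divides all others, since remainders are again
    multipliers. *)
Lemma mahler_ideal_generator q0 : q0 != 0 ->
  mahler_span k f 1 (fps_of_poly q0 * f) ->
  exists q, [/\ q != 0, mahler_span k f 1 (fps_of_poly q * f)
    & forall p, mahler_span k f 1 (fps_of_poly p * f) -> q %| p].
Proof.
move=> q00 q0f.
pose P s := `[< exists q, [/\ q != 0, mahler_span k f 1 (fps_of_poly q * f)
  & size q = s] >].
have exP : exists s, P s by exists (size q0); apply/asboolP; exists q0.
case: (ex_minnP exP) => s /asboolP[q [qn0 qf sq]] min_s.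
exists q; split=> // p pf; apply: contrapT => /negP; rewrite /dvdp => r0.
have /min_s : P (size (p %% q)).
  apply/asboolP; exists (p %% q); split=> //.
  have -> : p %% q = p + - (p %/ q) * q.
    by rewrite {2}(divp_eq p q) mulNr addrAC subrr add0r.
  rewrite rmorphD mulrDl; apply: mahler_span_add => //.
  by rewrite rmorphM -mulrA; apply: mahler_span_mul.
by rewrite -sq leqNgt ltn_modp qn0.
Qed.

Lemma regular_calm q0 : q0 != 0 ->
  (forall a, is_root_of_unity a -> ~~ root q0 a) ->
  mahler_span k f 1 (fps_of_poly q0 * f) -> regular_fps k f ->
  exists (N : nat) (e : 'I_N -> ratfun K),
    [/\ (1 <= N)%N, calm_sequence k e & mahler_equation k e f].
Proof.
move=> q00 q0u q0f reg.
have [q [qn0 qf q_dvd]] := mahler_ideal_generator q00 q0f.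
have [b b0 bP] := regular_denominator q00 q0f reg.
have q_root a : root q a -> a = 0.
  move=> ra; apply: contrapT => /eqP a0.
  have nu : ~ is_root_of_unity a.
    by move=> /q0u /negP; apply; apply: root_dvdp ra; exact: q_dvd.
  (* The positive exponent [e.+1] ensures that b(z^(k^(e+1))) is in the ideal, hence divisible by
     [q]. *)
  have [e] := exists_pow_nonroot b0 a0 nu; case/negP.
  rewrite -(hornerXn a (k ^ e.+1)) rootE -horner_comp.
  by apply: root_dvdp ra; apply: q_dvd; apply: mahler_spanW (bP e.+1).
have [N [p pE]] := mahler_span_coef qf.
exists N.+1, (fun i => (p i)%:F / q%:F); split=> // [i a anx pole|].
  by apply: anx; left; apply: q_root; exact: has_pole_root pole.
exact: (mahler_equation_of_poly qn0 pE).
Qed.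

End RegularToCalm.

(** * Calm implies regular *)

Section PoleAtZero.
Variables (K : fieldType) (k N a : nat) (g : fps K) (r : 'I_N -> {poly K}).
Hypothesis k_gt1 : (1 < k)%N.
Hypothesis g_eq : fps_of_poly 'X^a * g
  = \sum_(i < N) fps_of_poly (r i) * fps_subst_pow (k ^ i.+1) g.
Implicit Types (p u : {poly K}).

(** The factor z^a absorbs the pole at 0 in the equation of [g]. *)
Definition bounded_span D (v : fps K) := exists2 p : nat -> {poly K},
  forall i, (size (p i) <= D)%N
  & fps_of_poly 'X^a * v
    = \sum_(i < N.+1) fps_of_poly (p i) * fps_subst_pow (k ^ i) g.

Lemma bounded_span_cartier D s v :
  (forall i, size (r i) + k * a <= D)%N -> (s < k)%N ->
  bounded_span D v -> bounded_span D (cartier k s v).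
Proof.
move=> rD sk [p pD pv]; have k0 : (0 < k)%N := ltnW k_gt1.
(* Multiplying z^a v by z^a lets [g_eq] eliminate p_0 z^a g; the power z^((k-2)a) completes z^(ka),
   which passes through Lambda_s as z^a. *)
pose c i := 'X^((k - 2) * a) * (p 0%N * r i + 'X^a * p i.+1).
have cD i : (size (c i) <= k * D)%N.
  have szM (p1 p2 : {poly K}) : (size (p1 * p2)%R <= size p1 + size p2)%N.
    by rewrite (leq_trans (size_polyMleq _ _)) ?leq_pred.
  have szX n p1 : (size ('X^n * p1)%R <= n + size p1)%N.
    by rewrite (leq_trans (size_polyMleq _ _)) // size_polyXn.
  rewrite (leq_trans (szX _ _)) //.
  have : (size (p 0%N * r i + 'X^a * p i.+1)%R
      <= maxn (D + size (r i)) (a + D))%N.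
    rewrite (leq_trans (size_polyD _ _)) // geq_max !leq_max.
    have sz1 : (size (p 0%N * r i)%R <= D + size (r i))%N.
      by rewrite (leq_trans (szM _ _)) // leq_add2r.
    have sz2 : (size ('X^a * p i.+1)%R <= a + D)%N.
      by rewrite (leq_trans (szX _ _)) // leq_add2l.
    by rewrite sz1 sz2 orbT.
  have kD : (2 * D <= k * D)%N by rewrite leq_mul2r k_gt1 orbT.
  have ka : ((k - 2) * a + 2 * a = k * a)%N by rewrite -mulnDl subnK.
  have aux S1 S2 : (S1 <= maxn (D + S2) (a + D) -> S2 + k * a <= D ->
      (k - 2) * a + S1 <= k * D)%N by lia.
  by move=> /aux; apply; exact: rD.
(* Lambda_s lowers each M^(i+1) g to M^i g, so the coefficient of M^N g, and every later default, is
   0. *)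
exists (fun j => oapp (fun i => poly_cartier k s (c i)) 0 (insub j)).
  move=> j; case: insubP => [i _ _|_] /=; last by rewrite size_poly0.
  exact: size_poly_cartier.
have -> : fps_of_poly 'X^a * cartier k s v
    = cartier k s (fps_of_poly 'X^(k * a) * v).
  rewrite exprM -['X^k ^+ a]comp_Xn_poly -subst_pow_poly // [in RHS]mulrC.
  by rewrite cartier_mul_subst // mulrC.
have -> : fps_of_poly 'X^(k * a) * v
    = \sum_(i < N) fps_of_poly (c i) * fps_subst_pow (k ^ i.+1) g.
  have -> : (k * a = (k - 2) * a + (a + a))%N by nia.
  rewrite !exprD !rmorphM -!mulrA pv big_ord_recl expn0 subst_pow1 mulrDr.
  rewrite [fps_of_poly 'X^a * (_ * g)]mulrCA g_eq !mulr_sumr.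
  rewrite -big_split mulr_sumr.
  apply: eq_bigr => i _; rewrite rmorphM rmorphD !rmorphM -mulrA mulrDl.
  by rewrite !mulrA.
rewrite raddf_sum big_ord_recr /= insubF ?ltnn // raddf0 mul0r addr0.
apply: eq_bigr => i _; rewrite valK /= expnS -subst_pow_comp //.
by rewrite cartier_mul_subst // cartier_poly.
Qed.

Lemma bounded_span_coord D :
  exists C : (nat -> K^o) -> 'rV[K]_(N.+1 * D) -> Prop,
  [/\ forall v : nat -> K^o, C v 0 -> v = 0, C 0 0,
      forall b v x w y, C v x -> C w y -> C (b *: v + w) (b *: x + y)
    & forall v : nat -> K^o, bounded_span D (Fps v) -> exists x, C v x].
Proof.
(* The coordinates are the entries of the [N.+1] coefficient polynomials; if all are 0 then z^a v =
   0, so v = 0. *)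
exists (fun v x => fps_of_poly 'X^a * Fps (v : nat -> K) = \sum_(i < N.+1)
  fps_of_poly (rVpoly (row i (vec_mx x))) * fps_subst_pow (k ^ i) g).
have sum0 : \sum_(i < N.+1)
    fps_of_poly (rVpoly (row i (vec_mx (0 : 'rV_(N.+1 * D)))))
      * fps_subst_pow (k ^ i) g = 0 :> fps K.
  by rewrite big1 // => i _; rewrite !raddf0 mul0r.
split=> [v|||v [p pD ->]].
- rewrite sum0 => /eqP; rewrite mulf_eq0 -(raddf0 (@fps_of_poly K)).
  rewrite (inj_eq (@fps_of_poly_inj K)) expf_eq0 polyX_eq0 andbF /= raddf0.
  by move=> /eqP v0; apply/funext => n; exact: (congr1 (fun h => fcoef h n) v0).
- by rewrite sum0 (_ : Fps _ = 0) ?mulr0.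
- move=> b v x w y vx wy; rewrite Fps_linear mulrDr mulrCA vx wy mulr_sumr.
  rewrite -big_split; apply: eq_bigr => i _ /=.
  by rewrite !linearP /= rmorphD -mul_polyC rmorphM mulrDl mulrA.
- exists (mxvec (\matrix_(i < N.+1) poly_rV (p i))).
  by apply: eq_bigr => i _; rewrite mxvecK rowK poly_rV_K.
Qed.

Lemma regular_of_pole0 u : regular_fps k (fps_of_poly u * g).
Proof.
pose D := (\max_i size (r i) + k * a + size u)%N.
have rD i : (size (r i) + k * a <= D)%N.
  by rewrite (leq_trans _ (leq_addr _ _)) // leq_add2r (leq_bigmax i).
have [C [Cinj C0 CDZ CW]] := bounded_span_coord D.
apply: (finite_dimensional_coord Cinj C0 CDZ) => _ [e [s [sk ->]]].
apply: CW.
apply: (@cartier_pow_stable _ k (bounded_span D) _ (ltnW k_gt1)) => //.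
  (* The series u g itself needs a single coefficient z^a u, whose size [D] was chosen to
     accommodate. *)
  exists (fun i => if i == 0%N then 'X^a * u else 0) => [i|].
    case: ifP => _; last by rewrite size_poly0.
    rewrite (leq_trans (size_polyMleq _ _)) // size_polyXn /=.
    by rewrite /D leq_add2r (leq_trans (leq_pmull a (ltnW k_gt1))) ?leq_addl.
  rewrite big_ord_recl big1 => [|i _]; last by rewrite raddf0 mul0r.
  by rewrite expn0 subst_pow1 addr0 rmorphM mulrA.
by move=> s' v s'k; exact: bounded_span_cartier.
Qed.

End PoleAtZero.

(** * Removing the nonzero calm poles by a change of unknown series *)

Section CalmToRegular.
Variables (K : closedFieldType) (k : nat).
Hypothesis k_gt1 : (1 < k)%N.
Implicit Types (p q u : {poly K}).
Let k_gt0 : (0 < k)%N := ltnW k_gt1.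

(** Substitute z^m in the identity (z - 1)(-1 - z - z^2 - ...) = 1. *)
Lemma fps_geometric (R : idomainType) m : (0 < m)%N ->
  fps_of_poly ('X^m - 1) * fps_subst_pow m (Fps (fun=> - 1)) = 1 :> fps R.
Proof.
move=> m0; have -> : 'X^m - 1 = ('X - 1) \Po 'X^m :> {poly R}.
  by rewrite rmorphB rmorph1 /= comp_polyX.
rewrite -subst_pow_poly // -subst_powM //; set h := _ * _.
have -> : h = 1.
  apply: fpsP => -[|n] /=;
    rewrite big_ord_recl ?big_ord0 /= !coefB !coefX !coef1.
    by rewrite sub0r mulrNN mulr1 addr0.
  rewrite big_ord_recl big1 => [|i _]; rewrite !coefB !coefX !coef1 /=.
    by rewrite sub0r mulrNN subr0 mulr1 mul1r addr0 subrr.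
  by rewrite subrr mul0r.
rewrite -(rmorph1 (@fps_of_poly R)) subst_pow_poly //= rmorph1 //.
Qed.

(* Then f = u g turns f = sum_i (p_i / q) f(z^(k^i)) into an equation for g
   whose coefficients p_i u(z^(k^i)) / (q u) have no pole except at 0. *)
Definition clearable q := exists (a : nat) u (U : fps K),
  fps_of_poly u * U = 1
  /\ forall i, q * u %| 'X^a * (u \Po 'X^(k ^ i.+1)).

Lemma clearable1 : clearable 1.
Proof.
exists 0%N, 1, 1; rewrite rmorph1 mulr1; split=> // i.
by rewrite !mul1r dvd1p.
Qed.

Lemma clearableM q1 q2 : clearable q1 -> clearable q2 -> clearable (q1 * q2).
Proof.
move=> [a1 [u1 [U1 [uU1 d1]]]] [a2 [u2 [U2 [uU2 d2]]]].
exists (a1 + a2)%N, (u1 * u2), (U1 * U2); split=> [|i].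
  by rewrite rmorphM mulrACA uU1 uU2 mulr1.
by rewrite mulrACA exprD comp_polyM [X in _ %| X]mulrACA dvdp_mul.
Qed.

Lemma clearable_calm x : calm_number k x -> clearable ('X - x%:P).
Proof.
case=> [->|[m xm m_k]].
  (* The factor z is absorbed by z^a with a = 1, without changing the unknown. *)
  exists 1%N, 1, 1; rewrite rmorph1 mulr1; split=> // i.
  by rewrite subr0 comp_polyC mulr1.
have m0 := prim_order_gt0 xm; set d := gcdn m k.
have d1 : (1 < d)%N by rewrite ltn_neqAle eq_sym gcdn_gt0 m0 andbT; exact: m_k.
(* [M] is the l of the overview: it is less than m, so x^M <> 1, while m = M d divides M k. *)
pose M := (m %/ d)%N; have Md : (M * d = m)%N by rewrite divnK // dvdn_gcdl.
have M0 : (0 < M)%N by rewrite -(ltn_pmul2r (ltnW d1)) mul0n Md.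
have xM : x ^+ M != 1.
  by rewrite -(prim_order_dvd xm) gtnNdvd // -[X in (_ < X)%N]Md ltn_Pmulr.
exists 0%N, ('X^M - 1), (fps_subst_pow M (Fps (fun=> - 1))).
split=> [|i]; first exact: fps_geometric.
rewrite mul1r rmorphB rmorph1 /= comp_Xn_poly exprAC.
rewrite [_ ^+ (k ^ _) - 1]subrX1 [X in _ %| X]mulrC.
(* [t] is (z^(M k^(i+1)) - 1) / (z^M - 1); as [x] is a root of the numerator but not of the
   denominator, it is a root of [t]. *)
apply: dvdp_mul => //; rewrite dvdp_XsubCl; set t := \sum_(_ < _) _.
have xk : x ^+ (M * k ^ i.+1) == 1.
  rewrite -(prim_order_dvd xm) -Md expnS mulnA; apply/dvdn_mulr/dvdn_mul => //.
  exact: dvdn_gcdr.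
have /(congr1 (horner^~ x)) := subrX1 ('X^M : {poly K}) (k ^ i.+1).
rewrite -exprM hornerM !hornerD !hornerN !hornerC !hornerXn (eqP xk) subrr.
by move/esym/eqP; rewrite mulf_eq0 subr_eq0 (negPf xM).
Qed.

Lemma clearable_calm_roots q : q != 0 ->
  (forall x, root q x -> calm_number k x) -> clearable q.
Proof.
have [rs qE] := closed_field_poly_normal q; move=> q0 calm_q.
have : clearable (\prod_(x <- rs) ('X - x%:P)).
  have : forall x, x \in rs -> calm_number k x.
    move=> x xrs; apply: calm_q; rewrite qE rootZ ?lead_coef_eq0 //.
    by rewrite root_prod_XsubC.
  elim: rs {qE} => [|x rs IH] calm_rs.
    by rewrite big_nil; exact: clearable1.
  rewrite big_cons; apply: clearableM.
    by apply: clearable_calm; apply: calm_rs; rewrite mem_head.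
  by apply: IH => y y_rs; apply: calm_rs; rewrite inE y_rs orbT.
move=> [a [u [U [uU du]]]]; exists a, u, U; split=> // i.
by rewrite qE -scalerAl dvdpZl ?lead_coef_eq0.
Qed.

Lemma calm_regular (f : fps K) N (e : 'I_N -> ratfun K) :
  calm_sequence k e -> mahler_equation k e f -> regular_fps k f.
Proof.
move=> calm_e /mahler_equation_clear[q [p [q0 q_pole qf]]].
have [|a [u [U [uU du]]]] := clearable_calm_roots q0.
  move=> x /q_pole[i pole_x]; apply: contrapT => anx.
  exact: (calm_e i x anx).
have u0 : u != 0.
  by apply/eqP => u0; move/eqP: uU; rewrite u0 raddf0 mul0r eq_sym oner_eq0.
have fE : f = fps_of_poly u * (U * f) by rewrite mulrA uU mul1r.
(* Cancelling [q * u] in the equation of f = u g will leave z^a g = sum_i p_i t_i M^(i+1) g. *)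
have /choice[t tE] i : exists t : {poly K},
    'X^a * (u \Po 'X^(k ^ i.+1)) = t * (q * u).
  exact/dvdpP/du.
rewrite fE; apply: (@regular_of_pole0 K k N a _ (fun i => p i * t i)) => //.
move: (U * f) fE => g fE.
have qu0 : fps_of_poly (q * u) != 0.
  by rewrite -(raddf0 (@fps_of_poly K)) (inj_eq (@fps_of_poly_inj K)) mulf_neq0.
apply: (mulfI qu0); rewrite mulrCA rmorphM -[in LHS]mulrA -fE qf !mulr_sumr.
apply: eq_bigr => i _; have ki0 : (0 < k ^ i.+1)%N by rewrite expn_gt0 k_gt0.
rewrite [in LHS]fE subst_powM // subst_pow_poly // !mulrA -!rmorphM.
congr (fps_of_poly _ * _).
by rewrite mulrAC tE mulrC mulrA mulrC mulrCA !mulrA.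
Qed.

End CalmToRegular.

Theorem theorem6 (K : closedFieldType) (k : nat)
    (k_ge2 : (2 <= k)%N)
    (k_coprime_char : forall p : nat, p \in [pchar K] -> coprime k p)
    (f : fps K) (n : nat) (n_ge1 : (1 <= n)%N)
    (c : 'I_n -> ratfun K)
    (f_eq : mahler_equation k c f)
    (f_min : forall m : nat, (m < n)%N ->
       ~ exists e : 'I_m -> ratfun K, mahler_equation k e f)
    (c_no_pole : forall (i : 'I_n) (a : K),
       is_root_of_unity a -> ~ has_pole (c i) a) :
  regular_fps k f <->
  exists (N : nat) (e : 'I_N -> ratfun K),
    [/\ (1 <= N)%N, calm_sequence k e & mahler_equation k e f].
Proof.
split=> [reg|[N [e [_ calm_e e_eq]]]]; last first.
  exact: (calm_regular k_ge2 calm_e e_eq).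
have [q [p [q0 q_pole qf]]] := mahler_equation_clear f_eq.
apply: (regular_calm k_ge2 q0) reg.
  (* Every root of [q] is a pole of some [c i]. *)
  by move=> a ua; apply/negP => /q_pole[i]; exact: c_no_pole.
rewrite qf; apply: mahler_span_sum => i; apply: mahler_span_mul.
exact: mahler_span_gen.
Qed.
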